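(* Let $p, q \in \mathbb{Z}$ and let $x_1$ be a real irrational root of $x^2+px+q=0$. Let $[a_0, a_1, \dots, a_{n-1}, a_n]$ be the period of the continued fraction expansion of $x_1$. Then the period, viewed as a cycle, is a palindrome: the cycle is symmetric about some point, which may be an element of the cycle or may lie between two elements of the cycle. Equivalently, there is an integer $s$ such that $a_i = a_{s-i}$ for all $i$, where indices are read modulo $n+1$.
   Context: The continued fraction expansion of a real number $x$ is $x=[c_0,c_1,c_2,\dots]=c_0+\cfrac{1}{c_1+\cfrac{1}{c_2+\cdots}}$ with $c_0\in\mathbb{Z}$ and $c_i\in\mathbb{Z}_{>0}$ for $i\ge 1$. For a real irrational root of a quadratic equation with integer coefficients this expansion is infinite and periodic past a certain index. Its period is the finite block of minimal length that is eventually repeated. The period is regarded as a cycle, that is, up to cyclic shift. *)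

(* Defs.v *)
From HB Require Import structures.
From mathcomp Require Import all_boot all_order all_algebra.
From mathcomp Require Import all_classical all_reals all_analysis.

Set Implicit Arguments.
Unset Strict Implicit.
Unset Printing Implicit Defensive.

Import Order.TTheory GRing.Theory Num.Theory.
Import numFieldNormedType.Exports.

Local Open Scope classical_set_scope.
Local Open Scope ring_scope.

(* The finite continued fraction [c 0, c 1, ..., c k]. *)
Fixpoint convergent (R : realType) (c : nat -> int) (k : nat) : R :=
  if k is k'.+1 then (c 0%N)%:~R + (convergent R (c \o succn) k')^-1
  else (c 0%N)%:~R.

(* x = [c 0, c 1, c 2, ...] as an infinite continued fraction.  The sign of
   c 0 is unconstrained; positivity of the other terms ensures that no
   denominator occurring in a convergent vanishes. *)
Definition cfrac_expansion (R : realType) (x : R) (c : nat -> int) : Prop :=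
  (forall i : nat, (0 < i)%N -> 0 < c i) /\
  (convergent R c k @[k --> \oo] --> x).

Definition cyc (n : nat) (a : n.+1.-tuple int) (i : int) : int :=
  nth 0 a `|(i %% n.+1%:Z)%Z|%N.

Definition eventually_repeats (c : nat -> int) (n : nat)
    (a : n.+1.-tuple int) : Prop :=
  exists N : nat, forall i : nat, c (N + i)%N = cyc a i%:Z.

(* The index N at which repetition starts is free, so this determines the
   block only up to cyclic shift. *)
Definition cf_period (c : nat -> int) (n : nat) (a : n.+1.-tuple int) : Prop :=
  eventually_repeats c a /\
  forall (m : nat) (b : m.+1.-tuple int), eventually_repeats c b -> (n <= m)%N.

Definition symmetric_about_element (n : nat) (a : n.+1.-tuple int)
    (j : int) : Prop :=
  forall k : int, cyc a (j + k) = cyc a (j - k).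

(* The centre lies between the elements of indices j and j + 1. *)
Definition symmetric_about_gap (n : nat) (a : n.+1.-tuple int)
    (j : int) : Prop :=
  forall k : int, cyc a (j + 1 + k) = cyc a (j - k).

Definition cycle_palindrome (n : nat) (a : n.+1.-tuple int) : Prop :=
  exists j : int, symmetric_about_element a j \/ symmetric_about_gap a j.

(* Main.v *)
Require Import Defs.
From HB Require Import structures.
From mathcomp Require Import all_boot all_order all_algebra.
From mathcomp Require Import all_classical all_reals all_analysis.
From mathcomp Require Import ring lra zify.

Import Order.TTheory GRing.Theory Num.Theory.
Import numFieldNormedType.Exports.

Local Open Scope classical_set_scope.
Local Open Scope ring_scope.

(** The palindrome comes from Galois' description of conjugation on continued
    fractions: if [z > 1] is a quadratic irrational whose conjugate [z'] lies in
    [(-1, 0)], then [-1 / z'] is expanded by reading the expansion of [z]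
    backwards.  Suppose moreover that the trace [z + z'] is an integer.  Then
    [- z'], which lies in [(0, 1)] and differs from [z] by an integer, is the
    fractional part of [z], so that [-1 / z'] is also the complete quotient of
    [z] of index 1: the expansion of [z] read forwards from index 1 is its
    expansion read backwards ([dual_quotient0]).

    In detail, let [d_k] be the partial quotients of [z], [z_k] its complete
    quotients, and [w_k = -1 / z_k'], the dual quotients.  Conjugating
    [z_k = d_k + 1 / z_{k+1}] gives [w_{k+1} = d_k + 1 / w_k], and [w_0 = z_1];
    hence [w_k] has the expansion
    [d_{k-1}, ..., d_1, d_0, d_1, d_2, ...], a sequence symmetric about [d_0].
    If [z_{N+L} = z_N], conjugation yields [w_{N+L} = w_N], which makes this
    symmetric sequence [L]-periodic; therefore [d_k = d_l] as soon as [L]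
    divides [k + l] ([reduced_partial_quotient_sym]).

    A root [x1] of a monic integral equation has integral trace and norm.  If it
    is the larger root, some translate [z = x1 + m] satisfies the above
    hypotheses; if it is the smaller one, a translate of [- x1] does, and
    negation does not alter the tail of an expansion ([common_tail_opp]).  So
    the period of [x1] is a period of such a [z].  The coincidence
    [z_{N+L} = z_N] holds because an expansion determines its number as the
    limit of the convergents. *)

(** * The Gauss map on irrational numbers *)

Definition gauss {R : realType} (y : R) : R := (y - (Num.floor y)%:~R)^-1.

Definition complete_quotient {R : realType} (y : R) (k : nat) : R :=
  iter k gauss y.

Definition partial_quotient {R : realType} (y : R) (k : nat) : int :=
  Num.floor (complete_quotient y k).

Lemma irrational_neq_ratr (R : realType) (y : R) (r : rat) :
  irrational y -> y != ratr r.
Proof. by move=> hy; apply/eqP => yr; apply: hy; exists r. Qed.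

Lemma irrational_neq_int (R : realType) (y : R) (m : int) :
  irrational y -> y != m%:~R.
Proof. by move=> hy; rewrite -ratr_int; apply: irrational_neq_ratr. Qed.

Lemma irrational_opp (R : realType) (y : R) : irrational y -> irrational (- y).
Proof.
by move=> hy [r _ ry]; apply: hy; exists (- r); rewrite // rmorphN /= ry opprK.
Qed.

Lemma irrational_addz (R : realType) (y : R) (m : int) :
  irrational y -> irrational (y + m%:~R).
Proof.
move=> hy [r _ ry]; apply: hy; exists (r - m%:~R) => //.
by rewrite rmorphB /= ratr_int ry addrK.
Qed.

Lemma irrational_inv (R : realType) (y : R) : irrational y -> irrational y^-1.
Proof.
by move=> hy [r _ ry]; apply: hy; exists r^-1; rewrite // fmorphV /= ry invrK.
Qed.

Lemma irrational_gauss (R : realType) (y : R) :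
  irrational y -> irrational (gauss y).
Proof.
by move=> hy; apply: irrational_inv; rewrite -mulrNz; apply: irrational_addz.
Qed.

Lemma irrational_complete_quotient (R : realType) (y : R) (k : nat) :
  irrational y -> irrational (complete_quotient y k).
Proof. by move=> hy; elim: k => //= k; apply: irrational_gauss. Qed.

Lemma fractional_part_itv (R : realType) (y : R) :
  irrational y -> 0 < y - (Num.floor y)%:~R < 1.
Proof.
move=> hy; have /andP[lo hi] := floor_itv y.
have ne := irrational_neq_int _ _ (Num.floor y) hy.
rewrite subr_gt0 lt_neqAle eq_sym ne lo /=.
by rewrite intrD in hi; lra.
Qed.

Lemma gauss_gt1 (R : realType) (y : R) : irrational y -> 1 < gauss y.
Proof. by move=> /fractional_part_itv/andP[p0 p1]; rewrite invf_gt1. Qed.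

Lemma complete_quotientS (R : realType) (y : R) (k : nat) :
  complete_quotient y k =
  (partial_quotient y k)%:~R + (complete_quotient y k.+1)^-1.
Proof. by rewrite /complete_quotient /= /gauss invrK addrC subrK. Qed.

Lemma complete_quotientD (R : realType) (y : R) (k l : nat) :
  complete_quotient y (k + l) = complete_quotient (complete_quotient y k) l.
Proof. by rewrite /complete_quotient addnC iterD. Qed.

Lemma partial_quotientD (R : realType) (y : R) (k l : nat) :
  partial_quotient y (k + l) = partial_quotient (complete_quotient y k) l.
Proof. by rewrite /partial_quotient complete_quotientD. Qed.

(** Identifies the beginning of an expansion from an equation, without computing
    any floor. *)
Lemma gauss_unique (R : realType) (y t : R) (m : int) :
  y = m%:~R + t^-1 -> 1 < t -> Num.floor y = m /\ gauss y = t.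
Proof.
move=> -> t1; have t0 : 0 < t by lra.
have i0 : 0 < t^-1 by rewrite invr_gt0.
have i1 : t^-1 < 1 by rewrite invf_lt1.
have fl : Num.floor (m%:~R + t^-1) = m.
  by apply: floor_def; rewrite intrD; apply/andP; split; lra.
by split=> //; rewrite /gauss fl addrC addKr invrK.
Qed.

Lemma gauss_addz (R : realType) (y : R) (m : int) :
  gauss (y + m%:~R) = gauss y.
Proof.
by rewrite /gauss floorDrz ?intr_int // intrKfloor intrD; congr (_ ^-1); ring.
Qed.

(** * Convergents and the Gauss map *)

Lemma convergent_ge1 (R : realType) (c : nat -> int) (k : nat) :
  (forall i, 0 < c i) -> 1 <= convergent R c k.
Proof.
elim: k c => [|k IH] c cp /=.
  by rewrite ler1z; have := cp 0%N; lia.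
have c1 : (1 : R) <= (c 0%N)%:~R by rewrite ler1z; have := cp 0%N; lia.
have /(lt_le_trans ltr01) h : 1 <= convergent R (c \o succn) k.
  by apply: IH => i; apply: cp.
have := h; rewrite -invr_gt0; lra.
Qed.

(** The convergents of the shifted sequence are the images of the convergents
    of [c] under the continuous map [u |-> (u - c 0)^-1]; so they tend to the
    Gauss image of [x] as soon as [c 0] is the floor of [x].  Irrationality
    excludes the ends of the interval in which the limit lies. *)
Lemma cfrac_expansion_gauss (R : realType) (x : R) (c : nat -> int) :
  irrational x -> cfrac_expansion x c ->
  Num.floor x = c 0%N /\ cfrac_expansion (gauss x) (c \o succn).
Proof.
move=> hx [cpos ccvg].
have tail_ge1 k : 1 <= convergent R (c \o succn) k.
  by apply: convergent_ge1 => i; apply: cpos.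
have inv_tail k : 0 <= (convergent R (c \o succn) k)^-1 <= 1.
  have t0 := lt_le_trans ltr01 (tail_ge1 k).
  by rewrite invr_ge0 (ltW t0) /= invf_le1.
have ccvgS : (c 0%N)%:~R + (convergent R (c \o succn) k)^-1 @[k --> \oo] --> x.
  by rewrite -cvg_shiftS in ccvg.
have lo : (c 0%N)%:~R <= x.
  by apply: (cvgr_to_ge ccvgS); near=> k; have := inv_tail k; lra.
have hi : x <= (c 0%N)%:~R + 1.
  by apply: (cvgr_to_le ccvgS); near=> k; have := inv_tail k; lra.
have ne0 := irrational_neq_int _ _ (c 0%N) hx.
have ne1 := irrational_neq_int _ _ (c 0%N + 1) hx.
have fl : Num.floor x = c 0%N.
  by apply: floor_def; rewrite lo lt_neqAle ne1 intrD.
split=> //; split=> [i _|]; first exact: cpos.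
rewrite /gauss fl.
have -> : convergent R (c \o succn) =
    (fun k => ((c 0%N)%:~R + (convergent R (c \o succn) k)^-1
               - (c 0%N)%:~R)^-1).
  by apply/funext => k; rewrite addrAC subrr add0r invrK.
apply: cvgV; first by rewrite subr_eq0.
by apply: cvgB ccvgS _; apply: cvg_cst.
Unshelve. all: by end_near. Qed.

Lemma cfrac_expansion_complete_quotient (R : realType) (x : R)
    (c : nat -> int) (k : nat) :
  irrational x -> cfrac_expansion x c ->
  cfrac_expansion (complete_quotient x k) (fun i => c (k + i)%N).
Proof.
move=> hx hc; elim: k => [|k IH] //=.
have [_ h] := cfrac_expansion_gauss _ _ _
  (irrational_complete_quotient _ _ k hx) IH.
by congr (cfrac_expansion _ _): h; apply/funext => i /=; rewrite addnS.
Qed.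

Lemma cfrac_expansion_partial_quotient (R : realType) (x : R)
    (c : nat -> int) (k : nat) :
  irrational x -> cfrac_expansion x c -> c k = partial_quotient x k.
Proof.
move=> hx hc.
have [fl _] := cfrac_expansion_gauss _ _ _
  (irrational_complete_quotient _ _ k hx)
  (cfrac_expansion_complete_quotient _ _ _ k hx hc).
by rewrite /partial_quotient fl addn0.
Qed.

Lemma cfrac_expansion_unique (R : realType) (x y : R) (c : nat -> int) :
  cfrac_expansion x c -> cfrac_expansion y c -> x = y.
Proof.
move=> [_ cx] [_ cy].
rewrite -(cvg_lim (@norm_hausdorff _ R) cx).
by rewrite (cvg_lim (@norm_hausdorff _ R) cy).
Qed.

(** Since a number is the limit of its convergents, a repetition among the
    partial quotients is a repetition among the complete quotients. *)
Lemma eventually_repeats_complete_quotient (R : realType) (x : R)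
    (c : nat -> int) (n : nat) (a : n.+1.-tuple int) :
  irrational x -> cfrac_expansion x c -> eventually_repeats c a ->
  exists N, complete_quotient x (N + n.+1) = complete_quotient x N.
Proof.
move=> hx hc [N cN]; exists N.
apply: (@cfrac_expansion_unique _ _ _ (fun i => c (N + i)%N)).
  have := cfrac_expansion_complete_quotient _ _ _ (N + n.+1) hx hc.
  congr (cfrac_expansion _ _); apply/funext => i.
  by rewrite -addnA !cN /cyc PoszD modzDl.
exact: cfrac_expansion_complete_quotient.
Qed.

(** Negation changes only the beginning of the expansion.  Write
    [x = m + u^-1] with [u = gauss x > 1].  Then
    [- x = (- m - 1) + (1 + (u - 1)^-1)^-1].  If [2 < u], this is a legitimate
    beginning of expansion and [u - 1] has the same tail as [u]; if [u < 2],
    then [gauss u = (u - 1)^-1] and [1 + gauss u] has the same tail as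
    [gauss u]. *)
Lemma common_tail_opp (R : realType) (x : R) :
  irrational x ->
  exists i j, complete_quotient (- x) i = complete_quotient x j.
Proof.
move=> hx; have u1 := gauss_gt1 _ _ hx.
have hu := irrational_gauss _ _ hx.
have xE : x = (Num.floor x)%:~R + (gauss x)^-1
  by exact: (complete_quotientS _ x 0).
set u := gauss x in u1 hu xE; set m := Num.floor x in xE.
have u0 : u != 0 by apply/eqP; lra.
have um1 : u - 1 != 0 by apply/eqP; lra.
have i0 : 0 < (u - 1)^-1 by rewrite invr_gt0; lra.
have [_ gNx] : Num.floor (- x) = - m - 1 /\ gauss (- x) = 1 + (u - 1)^-1.
  apply: gauss_unique; last by lra.
  have -> : 1 + (u - 1)^-1 = u / (u - 1) by field.
  by rewrite xE invf_div intrD mulrNz; field.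
have [u2|u2] := ltP u 2.
  have [_ gu] : Num.floor u = 1 /\ gauss u = (u - 1)^-1.
    apply: gauss_unique; first by rewrite invrK; lra.
    by rewrite invf_gt1; lra.
  exists 2%N, 3%N; rewrite /complete_quotient /= gNx -/u gu addrC.
  exact: (gauss_addz _ _ 1).
have une2 := irrational_neq_int _ _ 2 hu.
have {}u2 : 1 < u - 1 by move/eqP: une2; lra.
have [_ g1] := gauss_unique _ _ _ 1 (erefl _) u2.
exists 3%N, 2%N; rewrite /complete_quotient /= gNx g1 -/u.
exact: (gauss_addz _ _ (-1)).
Qed.

(** * Conjugation *)

(** [y] and [y'] are conjugate numbers of the quadratic field generated by
    [z], when [z'] is the conjugate of [z]. *)
Definition conjugates {R : realType} (z z' y y' : R) : Prop :=
  exists u v : rat, y = ratr u + ratr v * z /\ y' = ratr u + ratr v * z'.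

(** As [z] is irrational, [1] and [z] are linearly independent over the
    rationals. *)
Lemma conjugates_fun (R : realType) (z z' y y1 y2 : R) :
  irrational z -> conjugates z z' y y1 -> conjugates z z' y y2 -> y1 = y2.
Proof.
move=> hz [u1 [v1 [yE1 ->]]] [u2 [v2 [yE2 ->]]].
have [vE|vne] := eqVneq v1 v2.
  by move: yE2; rewrite yE1 vE => /addIr->.
case: hz; exists ((u2 - u1) / (v1 - v2)) => //.
have dv : ratr v1 - ratr v2 != 0 :> R by rewrite subr_eq0 fmorph_eq.
rewrite fmorph_div /= !rmorphB /=; apply: (mulfI dv).
rewrite mulrCA divff // mulr1 mulrBl.
by move: yE2; rewrite yE1; lra.
Qed.

Lemma conjugates_subz (R : realType) (z z' y y' : R) (m : int) :
  conjugates z z' y y' -> conjugates z z' (y - m%:~R) (y' - m%:~R).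
Proof.
move=> [u [v [-> ->]]]; exists (u - m%:~R), v.
by rewrite rmorphB /= ratr_int; split; ring.
Qed.

(** The inverse of [y] is [y'] divided by the norm [y * y'], and [z + z'] and
    the norm are rational. *)
Lemma conjugates_inv (R : realType) (z z' y y' : R) (t s : int) :
  z + z' = t%:~R -> z * z' = s%:~R -> y != 0 -> y' != 0 ->
  conjugates z z' y y' -> conjugates z z' y^-1 y'^-1.
Proof.
move=> zt zs y0 y'0 [u [v [yE y'E]]].
pose N : rat := u ^+ 2 + u * v * t%:~R + v ^+ 2 * s%:~R.
have NE : ratr N = y * y'.
  rewrite yE y'E /N !(rmorphD, rmorphM, rmorphXn) /= !ratr_int -zt -zs; ring.
exists ((u + v * t%:~R) / N), (- v / N).
rewrite !fmorph_div /= NE !(rmorphD, rmorphM, rmorphN) /= ratr_int.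
split.
  have -> : y^-1 = y' / (y * y') by field; rewrite ?y0 ?y'0.
  by rewrite {1}y'E -zt; ring.
have -> : y'^-1 = y / (y * y') by field; rewrite ?y0 ?y'0.
by rewrite {1}yE -zt; ring.
Qed.

Fixpoint conjugate_quotient {R : realType} (z z' : R) (k : nat) : R :=
  if k is k'.+1
  then (conjugate_quotient z z' k' - (partial_quotient z k')%:~R)^-1
  else z'.

Lemma complete_quotient_gt1 (R : realType) (z : R) (k : nat) :
  irrational z -> 1 < z -> 1 < complete_quotient z k.
Proof.
case: k => //= k hz _; apply: gauss_gt1.
exact: irrational_complete_quotient.
Qed.

(** If [1 < z] and its conjugate lies in [(-1, 0)], then the same holds for all
    complete quotients of [z]: the partial quotients are at least 1, so
    subtracting one of them moves [(-1, 0)] below [-1]. *)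
Lemma conjugate_quotient_itv (R : realType) (z z' : R) (k : nat) :
  irrational z -> 1 < z -> -1 < z' < 0 ->
  -1 < conjugate_quotient z z' k < 0.
Proof.
move=> hz z1 z'itv; elim: k => //= k IH.
have d1 : 1 <= (partial_quotient z k)%:~R :> R.
  rewrite ler1z floor_ge_int; exact/ltW/complete_quotient_gt1.
set e := _ - _; have e1 : 1 < - e by rewrite /e; lra.
have i1 : (- e)^-1 < 1 by rewrite invf_lt1; lra.
have i0 : 0 < (- e)^-1 by rewrite invr_gt0; lra.
by rewrite invrN in i0 i1; lra.
Qed.

Lemma conjugates_complete_quotient (R : realType) (z z' : R) (t s : int)
    (k : nat) :
  irrational z -> z + z' = t%:~R -> z * z' = s%:~R -> 1 < z -> -1 < z' < 0 ->
  conjugates z z' (complete_quotient z k) (conjugate_quotient z z' k).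
Proof.
move=> hz zt zs z1 z'itv; elim: k => [|k IH] /=.
  by exists 0, 1; rewrite !rmorph0 !rmorph1 !add0r !mul1r.
apply: conjugates_inv zt zs _ _ (conjugates_subz _ _ _ _ _ _ IH).
  rewrite subr_eq0; apply: irrational_neq_int.
  exact: irrational_complete_quotient.
have d1 : 1 <= (partial_quotient z k)%:~R :> R.
  rewrite ler1z floor_ge_int; exact/ltW/complete_quotient_gt1.
have := conjugate_quotient_itv _ _ _ k hz z1 z'itv.
by move=> h; apply/eqP; lra.
Qed.

(** * Reversal of the expansion *)

(** [-1 / y'] for the conjugate [y'] of the [k]-th complete quotient of [z]:
    its expansion begins with the partial quotients of [z] of index below [k] in
    the reverse order. *)
Definition dual_quotient {R : realType} (z z' : R) (k : nat) : R :=
  - (conjugate_quotient z z' k)^-1.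

Lemma dual_quotient_gt1 (R : realType) (z z' : R) (k : nat) :
  irrational z -> 1 < z -> -1 < z' < 0 -> 1 < dual_quotient z z' k.
Proof.
move=> hz z1 z'itv; have := conjugate_quotient_itv _ _ _ k hz z1 z'itv.
by rewrite /dual_quotient -invrN => h; rewrite invf_gt1; lra.
Qed.

(** Conjugating [z_k = d_k + 1 / z_{k+1}] and solving for [-1 / z'_{k+1}]
    turns the recurrence around. *)
Lemma dual_quotientS (R : realType) (z z' : R) (k : nat) :
  irrational z -> 1 < z -> -1 < z' < 0 ->
  Num.floor (dual_quotient z z' k.+1) = partial_quotient z k /\
  gauss (dual_quotient z z' k.+1) = dual_quotient z z' k.
Proof.
move=> hz z1 z'itv; apply: gauss_unique; last exact: dual_quotient_gt1.
by rewrite /dual_quotient /= invrN !invrK; ring.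
Qed.

Lemma complete_quotient_dual (R : realType) (z z' : R) (k i : nat) :
  irrational z -> 1 < z -> -1 < z' < 0 ->
  complete_quotient (dual_quotient z z' (k + i)) i = dual_quotient z z' k.
Proof.
move=> hz z1 z'itv; elim: i => [|i IH]; first by rewrite addn0.
have [_ g] := dual_quotientS _ _ _ (k + i) hz z1 z'itv.
by rewrite addnS /complete_quotient iterSr g.
Qed.

Lemma partial_quotient_dual (R : realType) (z z' : R) (k i : nat) :
  irrational z -> 1 < z -> -1 < z' < 0 ->
  partial_quotient (dual_quotient z z' (k + i).+1) i = partial_quotient z k.
Proof.
move=> hz z1 z'itv; rewrite -addSn /partial_quotient complete_quotient_dual //.
by have [-> _] := dual_quotientS _ _ _ k hz z1 z'itv.
Qed.

(** Here the symmetry arises: [- z'] lies in [(0, 1)] and [z = t + (- z')] with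
    [t] an integer, so that [- z'] is the fractional part of [z]. *)
Lemma dual_quotient0 (R : realType) (z z' : R) (t : int) :
  z + z' = t%:~R -> -1 < z' < 0 -> dual_quotient z z' 0 = gauss z.
Proof.
move=> zt z'itv; rewrite /dual_quotient /= -invrN.
have [||_ ->//] := @gauss_unique _ z (- z')^-1 t.
  by rewrite invrK -zt; ring.
by rewrite invf_gt1; lra.
Qed.

Lemma partial_quotient_dual_ge (R : realType) (z z' : R) (t : int)
    (k i : nat) :
  irrational z -> z + z' = t%:~R -> 1 < z -> -1 < z' < 0 ->
  partial_quotient (dual_quotient z z' k) (k + i) = partial_quotient z i.+1.
Proof.
move=> hz zt z1 z'itv.
rewrite partial_quotientD (complete_quotient_dual _ _ _ 0) //.
by rewrite (dual_quotient0 _ _ _ t) // -add1n partial_quotientD.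
Qed.

(** With [d_k] the partial quotients of [z], the [k]-th dual quotient is
    [d_{k-1}, ..., d_1, d_0, d_1, d_2, ...].  Conjugating [z_{N+L} = z_N] shows
    that the dual quotients of index [M] and [M + L] agree for all [M >= N].
    Comparing their first [M] terms gives [d_{j+L} = d_j] for [j < M], with [M]
    arbitrarily large; comparing the next ones gives [d_{1+i} = d_{L-1-i}] for
    [i < L]. *)
Lemma reduced_partial_quotient_sym (R : realType) (z z' : R) (t s : int)
    (L N : nat) :
  irrational z -> z + z' = t%:~R -> z * z' = s%:~R -> 1 < z -> -1 < z' < 0 ->
  (0 < L)%N -> complete_quotient z (N + L) = complete_quotient z N ->
  forall k l, (L %| k + l)%N -> partial_quotient z k = partial_quotient z l.
Proof.
move=> hz zt zs z1 z'itv L0 zN.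
have dual_per M : (N <= M)%N ->
    dual_quotient z z' (M + L) = dual_quotient z z' M.
  move=> NM; rewrite /dual_quotient; congr (- _ ^-1).
  apply: (conjugates_fun _ z z' (complete_quotient z M) _ _ hz); last first.
    exact: conjugates_complete_quotient zt zs z1 z'itv.
  have -> : complete_quotient z M = complete_quotient z (M + L).
    rewrite -(subnKC NM) addnAC !(complete_quotientD _ z _ (M - N)).
    by rewrite zN.
  exact: conjugates_complete_quotient zt zs z1 z'itv.
have per j : partial_quotient z (j + L) = partial_quotient z j.
  rewrite -(partial_quotient_dual _ z z' (j + L) N) //.
  rewrite -[RHS](partial_quotient_dual _ z z' j N) //.
  by rewrite addnAC -addSn dual_per //; lia.
have refl i : (i < L)%N ->
    partial_quotient z i.+1 = partial_quotient z (L - i.+1).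
  move=> iL.
  rewrite -(partial_quotient_dual_ge _ z z' t N i) // -dual_per //.
  have -> : (N + L = ((L - i.+1) + (N + i)).+1)%N by lia.
  by rewrite partial_quotient_dual.
have perM j m : partial_quotient z (j + m * L) = partial_quotient z j.
  by elim: m => [|m IH]; rewrite ?addn0 // mulSn addnCA addnC per.
have mod k : partial_quotient z k = partial_quotient z (k %% L).
  by rewrite {1}(divn_eq k L) addnC perM.
move=> k l kl; rewrite (mod k) (mod l).
have kL := ltn_pmod k L0; have lL := ltn_pmod l L0.
have : (L %| k %% L + l %% L)%N by rewrite /dvdn modnDm.
(* The two residues add up to 0 or to [L]. *)
move: (k %% L)%N (l %% L)%N kL lL => r r' rL r'L /dvdnP[m mE].
have m2 : (m < 2)%N by rewrite -(ltn_pmul2r L0); lia.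
case: m m2 mE => [|[|//]] _ mE.
  by congr partial_quotient; lia.
have [r0|rpos] := posnP r; first lia.
by rewrite -(prednK rpos) refl; [congr partial_quotient|]; lia.
Qed.

(** * From a root to a reduced number *)

(** The integer translate [z] of the larger root whose conjugate lies in
    [(-1, 0)] is reduced: otherwise [z] and its conjugate would both lie in
    [(-1, 1)], so that their product, an integer, would vanish. *)
Lemma exists_reduced_translate (R : realType) (y y' : R) (t s : int) :
  irrational y -> y + y' = t%:~R -> y * y' = s%:~R -> y' < y ->
  exists (m : int) (t' s' : int),
    [/\ (y + m%:~R) + (y' + m%:~R) = t'%:~R,
        (y + m%:~R) * (y' + m%:~R) = s'%:~R,
        1 < y + m%:~R & -1 < y' + m%:~R < 0].
Proof.
move=> hy yt ys y'y.
have hy' : irrational y'.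
  have -> : y' = - y + t%:~R by rewrite -yt; ring.
  exact/irrational_addz/irrational_opp.
pose m : int := - Num.floor y' - 1.
have mE : m%:~R = - (Num.floor y')%:~R - 1 :> R by rewrite intrD mulrNz.
have fr := fractional_part_itv _ _ hy'.
have z'itv : -1 < y' + m%:~R < 0 by rewrite mE; lra.
exists m, (t + m * 2), (s + m * t + m ^+ 2).
have zs : (y + m%:~R) * (y' + m%:~R) = (s + m * t + m ^+ 2)%:~R.
  by rewrite !(intrD, intrM, rmorphXn) /= -ys -yt; ring.
split=> //; first by rewrite intrD intrM -yt; ring.
have hz := irrational_addz _ _ m hy.
have hz' := irrational_addz _ _ m hy'.
have zne1 := irrational_neq_int _ _ 1 hz.
rewrite lt_neqAle eq_sym zne1 leNgt; apply/negP => zlt1.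
have s0 : s + m * t + m ^+ 2 = 0 :> int.
  have : `|(s + m * t + m ^+ 2)%:~R| < (1 : R).
    rewrite -zs normrM mulr_ilt1 // ltr_norml; lra.
  by rewrite -intr_norm ltrz1; lia.
move: zs; rewrite s0 => /eqP; rewrite mulf_eq0.
by rewrite !(negbTE (irrational_neq_int _ _ 0 _)).
Qed.

(** If [x] is the larger root, [z] is a translate of [x]; otherwise [- x] is the
    larger root of the equation with [p] replaced by [- p], and [z] is a
    translate of [- x]. *)
Lemma exists_reduced_common_tail (R : realType) (p q : int) (x : R) :
  irrational x -> x ^+ 2 + p%:~R * x + q%:~R = 0 ->
  exists (z z' : R) (t s : int) (i j : nat),
    [/\ irrational z, z + z' = t%:~R, z * z' = s%:~R, 1 < z & -1 < z' < 0] /\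
    complete_quotient z i = complete_quotient x j.
Proof.
move=> hx hroot; pose x' : R := - p%:~R - x.
have xs : x * x' = q%:~R by rewrite /x'; lra.
have xne : x != x'.
  apply/eqP => xx'; have := irrational_neq_ratr _ _ (- p%:~R / 2) hx.
  rewrite fmorph_div rmorphN /= !ratr_int ratr_nat => /eqP; apply.
  by rewrite /x' in xx'; lra.
have gauss_tail (y : R) m i : complete_quotient (y + m%:~R) i.+1 =
    complete_quotient y i.+1.
  by rewrite /complete_quotient !iterSr gauss_addz.
have [x'x|xx'] := ltP x' x.
  have [|m [t [s [zt zs z1 z'itv]]]] :=
      @exists_reduced_translate R x x' (- p) q hx _ xs x'x.
    by rewrite /x' mulrNz; ring.
  exists (x + m%:~R), (x' + m%:~R), t, s, 1%N, 1%N.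
  split; last exact: gauss_tail.
  by split=> //; apply: irrational_addz.
have hNx := irrational_opp _ _ hx.
have {}xx' : - x' < - x by rewrite ltrN2 lt_neqAle xne.
have [||m [t [s [zt zs z1 z'itv]]]] :=
  @exists_reduced_translate R (- x) (- x') p q hNx _ _ xx'.
- by rewrite /x'; ring.
- by rewrite mulrNN.
have [i [j ij]] := common_tail_opp _ _ hx.
exists (- x + m%:~R), (- x' + m%:~R), t, s, i.+1, j.+1; split.
  by split=> //; apply: irrational_addz.
by rewrite gauss_tail /complete_quotient !iterS -/(complete_quotient _ _) ij.
Qed.

Theorem theorem1 (R : realType) (p q : int) (x1 : R)
    (hroot : x1 ^+ 2 + p%:~R * x1 + q%:~R = 0)
    (hirr : @irrational R x1)
    (c : nat -> int) (hc : cfrac_expansion x1 c)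
    (n : nat) (a : n.+1.-tuple int) (ha : cf_period c a) :
  cycle_palindrome a /\
  exists s : int, forall i : int, cyc a i = cyc a (s - i).
Proof.
case: ha => rep _.
have [z [z' [t [s [i [j [[hz zt zs z1 z'itv] tail]]]]]]] :=
  exists_reduced_common_tail _ _ _ _ hirr hroot.
have [N0 xper] := eventually_repeats_complete_quotient _ _ _ _ _ hirr hc rep.
have zper : complete_quotient z (i + N0 + n.+1) = complete_quotient z (i + N0).
  rewrite -addnA !(complete_quotientD _ z i) tail -!complete_quotientD.
  by rewrite !(addnC j) !(complete_quotientD _ _ _ j) xper.
have sym := reduced_partial_quotient_sym _ _ _ _ _ _ _ hz zt zs z1 z'itv
  (ltn0Sn n) zper.
case: rep => N cN.
(* [cyc a k] is read off [c] at the index [N + j * n.+1] plus the residue of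
   [k]; the [j] extra periods bring that index into the tail shared with [z].
   Its position in the expansion of [z] is [M] plus the residue of [k]. *)
pose M := (N + j * n + i)%N.
have cycE (k : int) :
    cyc a k = partial_quotient z (M + `|(k %% n.+1%:Z)%Z|%N).
  have -> : cyc a k = cyc a (j * n.+1 + `|(k %% n.+1%:Z)%Z|)%N%:Z.
    rewrite /cyc PoszD PoszM modzMDl gez0_abs ?modz_ge0 //.
    by rewrite modz_mod.
  rewrite -cN (cfrac_expansion_partial_quotient _ _ _ _ hirr hc).
  set r := absz _.
  have -> : (N + (j * n.+1 + r) = j + (N + j * n + r))%N by lia.
  rewrite partial_quotientD -tail -partial_quotientD.
  by congr partial_quotient; rewrite /M; lia.
have refl (k l : int) : (n.+1%:Z %| M%:Z * 2 + k + l)%Z -> cyc a k = cyc a l.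
  move=> kl; rewrite !cycE; apply: sym.
  have -> : (n.+1 %| M + `|(k %% n.+1%:Z)%Z| + (M + `|(l %% n.+1%:Z)%Z|))%N =
    (n.+1%:Z %| M%:Z * 2 + (k %% n.+1%:Z)%Z + (l %% n.+1%:Z)%Z)%Z.
    rewrite -[RHS]/(_ %| `|_|)%N; congr (_ %| _)%N.
    have := @modz_ge0 k n.+1 isT; have := @modz_ge0 l n.+1 isT; lia.
  case/dvdzP: kl => w wE; apply/dvdzP.
  exists (w - (k %/ n.+1%:Z)%Z - (l %/ n.+1%:Z)%Z).
  rewrite !mulrBl -wE {2}(divz_eq k n.+1%:Z) {2}(divz_eq l n.+1%:Z); ring.
(* The element of index [- M] of the cycle is the partial quotient [d_0]. *)
split; last first.
  exists (- (M%:Z * 2)) => k; apply: refl.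
  by have -> : M%:Z * 2 + k + (- (M%:Z * 2) - k) = 0 by ring.
exists (- M%:Z); left => k; apply: refl.
by have -> : M%:Z * 2 + (- M%:Z + k) + (- M%:Z - k) = 0 by ring.
Qed.
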